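(* Let $\Lambda$ be a row-finite $k$-graph without sources, and let $R$ be a commutative ring with $1$. Then there is an $R$-algebra $\mathrm{KP}_R(\Lambda)$ generated by a Kumjian-Pask $\Lambda$-family $(p,s)$ such that, whenever $(Q,T)$ is a Kumjian-Pask $\Lambda$-family in an $R$-algebra $A$, there is a unique $R$-algebra homomorphism $\pi_{Q,T}:\mathrm{KP}_R(\Lambda)\to A$ such that $$\pi_{Q,T}(p_v)=Q_v,\quad \pi_{Q,T}(s_\lambda)=T_\lambda,\quad \pi_{Q,T}(s_{\mu^*})=T_{\mu^*}$$ for $v\in\Lambda^0$ and $\lambda,\mu\in\Lambda^{\neq 0}$. There is a $\mathbb{Z}^k$-grading on $\mathrm{KP}_R(\Lambda)$ satisfying $$\mathrm{KP}_R(\Lambda)_n=\mathrm{span}_R\{s_\lambda s_{\mu^*}:\lambda,\mu\in\Lambda\text{ and }d(\lambda)-d(\mu)=n\}\qquad(n\in\mathbb{Z}^k),$$ and we have $rp_v\neq 0$ for all $v\in\Lambda^0$ and $r\in R\setminus\{0\}$.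
   Context: Conventions: $\mathbb{N}$ includes $0$, and $k$ is a positive integer. For $m,n\in\mathbb{N}^k$, $m\le n$ is coordinatewise. Rings and $R$-algebras are associative but not assumed to have an identity, and homomorphisms are not assumed unit-preserving. A $k$-graph is a countable category $\Lambda$ (with object set $\Lambda^0$, set of morphisms also written $\Lambda$, domain map $s$, codomain map $r$; $\lambda\mu$ is defined when $s(\lambda)=r(\mu)$) together with a functor $d:\Lambda\to\mathbb{N}^k$ (where $\mathbb{N}^k$ is viewed as a category with one object) with the factorization property: if $d(\lambda)=m+n$ there are unique $\mu,\nu\in\Lambda$ with $d(\mu)=m$, $d(\nu)=n$, $\lambda=\mu\nu$. Objects are identified with identity morphisms, so $\Lambda^0=d^{-1}(0)$. Write $\Lambda^n=d^{-1}(n)$ and $v\Lambda^n=\{\lambda\in\Lambda^n:r(\lambda)=v\}$. $\Lambda$ is row-finite if every $v\Lambda^n$ ($v\in\Lambda^0$, $n\in\mathbb{N}^k$) is finite, and has no sources if every $v\Lambda^n$ is nonempty. Let $\Lambda^{\neq0}=\{\lambda\in\Lambda:d(\lambda)\neq0\}$. For each $\lambda\in\Lambda^{\neq0}$ introduce a formal symbol $\lambda^*$ (ghost path), and let $G(\Lambda^{\neq0})=\{\lambda^*:\lambda\in\Lambda^{\neq0}\}$. A Kumjian-Pask $\Lambda$-family $(P,S)$ in an $R$-algebra $A$ consists of functions $P:\Lambda^0\to A$ and $S:\Lambda^{\neq0}\cup G(\Lambda^{\neq0})\to A$ such that: (KP1) $\{P_v:v\in\Lambda^0\}$ is a family of mutually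 orthogonal idempotents; (KP2) for all $\lambda,\mu\in\Lambda^{\neq0}$ with $r(\mu)=s(\lambda)$: $S_\lambda S_\mu=S_{\lambda\mu}$, $S_{\mu^*}S_{\lambda^*}=S_{(\lambda\mu)^*}$, $P_{r(\lambda)}S_\lambda=S_\lambda=S_\lambda P_{s(\lambda)}$, $P_{s(\lambda)}S_{\lambda^*}=S_{\lambda^*}=S_{\lambda^*}P_{r(\lambda)}$; (KP3) for all $\lambda,\mu\in\Lambda^{\neq0}$ with $d(\lambda)=d(\mu)$: $S_{\lambda^*}S_\mu=\delta_{\lambda,\mu}P_{s(\lambda)}$; (KP4) for all $v\in\Lambda^0$ and $n\in\mathbb{N}^k\setminus\{0\}$: $P_v=\sum_{\lambda\in v\Lambda^n}S_\lambda S_{\lambda^*}$. By convention $S_v:=P_v$ and $S_{v^*}:=P_v$ for $v\in\Lambda^0$ (and likewise $s_v=s_{v^*}=p_v$). A $\mathbb{Z}^k$-grading on a ring $A$ is a family of additive subgroups $A_n$ ($n\in\mathbb{Z}^k$) with $A_mA_n\subset A_{m+n}$ and $A=\bigoplus_nA_n$ as an abelian group. *)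

(* Defs.v *)
From HB Require Import structures.
From mathcomp Require Import all_boot all_order all_algebra.
From mathcomp Require Import boolp classical_sets functions cardinality fsbigop.

Set Implicit Arguments.
Unset Strict Implicit.
Unset Printing Implicit Defensive.

Import GRing.Theory.

Local Open Scope classical_set_scope.
Local Open Scope ring_scope.

(* Associative algebras over a commutative ring, with no identity required:
   the library's algebra structures all come with a unit. *)

HB.mixin Record Lmodule_isNuAlgebra (R : comPzRingType) A
    of GRing.Lmodule R A := {
  numul : A -> A -> A;
  numulA : associative numul;
  numulDl : left_distributive numul +%R;
  numulDr : right_distributive numul +%R;
  nuscaleAl : forall (c : R) (x y : A), c *: numul x y = numul (c *: x) y;
  nuscaleAr : forall (c : R) (x y : A), c *: numul x y = numul x (c *: y)
}.

#[short(type="nuAlgType")]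
HB.structure Definition NuAlgebra (R : comPzRingType) :=
  {A of GRing.Lmodule R A & Lmodule_isNuAlgebra R A}.

Notation "x *~* y" := (numul x y) (at level 40, left associativity) : ring_scope.

Definition nualg_hom (R : comPzRingType) (A B : nuAlgType R) (f : A -> B) : Prop :=
  linear f /\ {morph f : x y / x *~* y >-> x *~* y}.

Definition is_subalgebra (R : comPzRingType) (A : nuAlgType R) (B : set A) : Prop :=
  [/\ B 0,
      forall x y, B x -> B y -> B (x + y),
      forall (c : R) x, B x -> B (c *: x)
    & forall x y, B x -> B y -> B (x *~* y)].

Definition generates (R : comPzRingType) (A : nuAlgType R) (X : set A) : Prop :=
  forall B : set A, is_subalgebra B -> X `<=` B -> B = setT.

Definition linear_span (R : comPzRingType) (A : lmodType R) (X : set A) : set A :=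
  [set x | exists n (c : 'I_n -> R) (y : 'I_n -> A),
     (forall i, X (y i)) /\ x = \sum_(i < n) c i *: y i].

Definition is_additive_subgroup (A : zmodType) (B : set A) : Prop :=
  B 0 /\ forall x y, B x -> B y -> B (x - y).

(* The last conjunct says that A is the direct sum of the G n. *)
Definition is_grading (k : nat) (R : comPzRingType) (A : nuAlgType R)
    (G : {ffun 'I_k -> int} -> set A) : Prop :=
  [/\ forall n, is_additive_subgroup (G n),
      forall m n x y, G m x -> G n y -> G (m + n) (x *~* y)
    & forall a : A, exists! f : {ffun 'I_k -> int} -> A,
        [/\ forall n, G n (f n),
            finite_set [set n | f n != 0]
          & a = \sum_(n \in [set: {ffun 'I_k -> int}]) f n]].

(* The composite [comp l m], written l m in the text, is meaningful only when
   [src l = rng m]; its other values are unconstrained and never used.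
   An object v is identified with the morphism [idm v]. *)
Record kgraph (k : nat) := KGraph {
  vertex : countType;
  path : countType;
  src : path -> vertex;
  rng : path -> vertex;
  idm : vertex -> path;
  comp : path -> path -> path;
  deg : path -> {ffun 'I_k -> nat};
  src_idm : forall v, src (idm v) = v;
  rng_idm : forall v, rng (idm v) = v;
  src_comp : forall l m, src l = rng m -> src (comp l m) = src m;
  rng_comp : forall l m, src l = rng m -> rng (comp l m) = rng l;
  comp_idl : forall l, comp (idm (rng l)) l = l;
  comp_idr : forall l, comp l (idm (src l)) = l;
  compA : forall l m n, src l = rng m -> src m = rng n ->
    comp l (comp m n) = comp (comp l m) n;
  deg_idm : forall v, deg (idm v) = 0;
  deg_comp : forall l m, src l = rng m -> deg (comp l m) = deg l + deg m;
  factorization : forall l (m n : {ffun 'I_k -> nat}), deg l = m + n ->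
    exists! p : path * path,
      [/\ src p.1 = rng p.2, deg p.1 = m, deg p.2 = n & l = comp p.1 p.2]
}.

Section KumjianPask.
Variables (k : nat) (L : kgraph k).

Definition paths_from (v : vertex L) (n : {ffun 'I_k -> nat}) : set (path L) :=
  [set l | rng l = v /\ deg l = n].

Definition row_finite : Prop := forall v n, finite_set (paths_from v n).

Definition no_sources : Prop := forall v n, paths_from v n !=set0.

Definition nzpath := {l : path L | deg l != 0}.

(* [Ghost l] is the formal symbol l^*. *)
Inductive symbol := Real of nzpath | Ghost of nzpath.

Section Family.
Variables (R : comPzRingType) (A : nuAlgType R).
Variables (P : vertex L -> A) (S : symbol -> A).

(* S_l and S_{l^*} for arbitrary paths l, with S_v = S_{v^*} = P_v. *)
Definition real_of (l : path L) : A :=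
  if insub l is Some l' then S (Real l') else P (rng l).

Definition ghost_of (l : path L) : A :=
  if insub l is Some l' then S (Ghost l') else P (rng l).

Definition KP1 : Prop :=
  (forall v, P v *~* P v = P v) /\ (forall v w, v <> w -> P v *~* P w = 0).

(* In the first conjunct lm is the composite of l and m, which again has
   nonzero degree. *)
Definition KP2 : Prop :=
  (forall l m lm : nzpath, src (val l) = rng (val m) ->
     val lm = comp (val l) (val m) ->
     S (Real l) *~* S (Real m) = S (Real lm) /\
     S (Ghost m) *~* S (Ghost l) = S (Ghost lm)) /\
  (forall l : nzpath,
     [/\ P (rng (val l)) *~* S (Real l) = S (Real l),
         S (Real l) *~* P (src (val l)) = S (Real l),
         P (src (val l)) *~* S (Ghost l) = S (Ghost l)
       & S (Ghost l) *~* P (rng (val l)) = S (Ghost l)]).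

Definition KP3 : Prop :=
  forall l m : nzpath, deg (val l) = deg (val m) ->
    S (Ghost l) *~* S (Real m) = if l == m then P (src (val l)) else 0.

(* The sum is finite, and has its intended value, for row-finite L. *)
Definition KP4 : Prop :=
  forall (v : vertex L) (n : {ffun 'I_k -> nat}), n != 0 ->
    P v = \sum_(l \in paths_from v n) (real_of l *~* ghost_of l).

Definition is_KP_family : Prop := [/\ KP1, KP2, KP3 & KP4].

Definition generator_set : set A := range P `|` range S.

Definition degree_diff (l m : path L) : {ffun 'I_k -> int} :=
  [ffun i => (deg l i)%:Z - (deg m i)%:Z].

Definition KP_component (n : {ffun 'I_k -> int}) : set A :=
  linear_span [set x | exists l m : path L,
    degree_diff l m = n /\ x = real_of l *~* ghost_of m].

End Family.
End KumjianPask.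

(* Main.v *)
(* KP_R(L) is the algebra of formal terms in the p_v, s_l, s_{l^*}, two terms
   being identified when they agree in every Kumjian-Pask family; the universal
   property is then immediate.  The remaining claims come from two families.

   - Grading.  The monomials s_l s_{m^*} span, because (KP4) rewrites
     s_{l^*} s_m as a sum of monomials of degree d(m) - d(l).  For directness,
     let s_l and s_{l^*} act on functions Z^k -> KP by left multiplication
     combined with the shift by d(l), resp. -d(l).  An element x of KP_n then
     acts by g |-> (j |-> x g(j - n)), so if a is the sum of the a_n in KP_n,
     then applying a to the function supported at 0 with value u recovers all
     the products a_n u, and these determine a_n since KP has local units.

   - Nonvanishing of r p_v.  KP_R(L) acts on germs at infinity of R-valued
     functions on finite paths (two functions being identified when they agree on all
     paths of large degree), and r p_v maps the constant 1 to the germ of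
     l |-> r [r(l) = v], which is nonzero as L has no sources. *)

Require Import Defs.
From HB Require Import structures.
From mathcomp Require Import all_boot all_order all_algebra.
From mathcomp Require Import finmap.
From mathcomp Require Import boolp classical_sets functions cardinality fsbigop.

Set Implicit Arguments.
Unset Strict Implicit.
Unset Printing Implicit Defensive.

Import GRing.Theory.

Local Open Scope classical_set_scope.
Local Open Scope ring_scope.
Local Open Scope quotient_scope.

(* Both names are shadowed by mathcomp's. *)
Local Notation path := Defs.path.
Local Notation comp := Defs.comp.

(** * Arithmetic and homomorphisms of algebras without identity *)

Section NuAlgebraTheory.
Variables (R : comPzRingType) (A : nuAlgType R).
Implicit Types x y z : A.

Lemma numul0l x : 0 *~* x = 0.
Proof. by apply: (addIr (0 *~* x)); rewrite -numulDl !add0r. Qed.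

Lemma numul0r x : x *~* 0 = 0.
Proof. by apply: (addIr (x *~* 0)); rewrite -numulDr !add0r. Qed.

Lemma numulNl x y : (- x) *~* y = - (x *~* y).
Proof. by apply: (addIr (x *~* y)); rewrite -numulDl !addNr numul0l. Qed.

Lemma numulBl x y z : (x - y) *~* z = x *~* z - y *~* z.
Proof. by rewrite numulDl numulNl. Qed.

Lemma numul_suml (I : Type) (r : seq I) (P : pred I) (F : I -> A) x :
  (\sum_(i <- r | P i) F i) *~* x = \sum_(i <- r | P i) F i *~* x.
Proof.
by apply: (big_morph (numul^~ x)) => [y z|]; rewrite ?numulDl ?numul0l.
Qed.

Lemma numul_sumr (I : Type) (r : seq I) (P : pred I) (F : I -> A) x :
  x *~* (\sum_(i <- r | P i) F i) = \sum_(i <- r | P i) x *~* F i.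
Proof.
by apply: (big_morph (numul x)) => [y z|]; rewrite ?numulDr ?numul0r.
Qed.

Lemma generates_ind (X B : set A) :
  generates X -> is_subalgebra B -> X `<=` B -> forall x, B x.
Proof. by move=> genX subB XB x; rewrite (genX _ subB XB). Qed.

End NuAlgebraTheory.

Section NuAlgebraHom.
Variables (R : comPzRingType) (A B : nuAlgType R) (f : A -> B).
Hypothesis f_hom : nualg_hom f.

Lemma nualg_homD x y : f (x + y) = f x + f y.
Proof. by have := f_hom.1 1 x y; rewrite !scale1r. Qed.

Lemma nualg_hom0 : f 0 = 0.
Proof. by apply: (addIr (f 0)); rewrite -nualg_homD !add0r. Qed.

Lemma nualg_homZ c x : f (c *: x) = c *: f x.
Proof. by have := f_hom.1 c x 0; rewrite !addr0 nualg_hom0 addr0. Qed.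

Lemma nualg_homM x y : f (x *~* y) = f x *~* f y.
Proof. exact: f_hom.2. Qed.

Lemma nualg_hom_sum (I : Type) (r : seq I) (P : pred I) (F : I -> A) :
  f (\sum_(i <- r | P i) F i) = \sum_(i <- r | P i) f (F i).
Proof. by apply: (big_morph f) => [y z|]; rewrite ?nualg_homD ?nualg_hom0. Qed.

End NuAlgebraHom.

(** The equalizer of two homomorphisms is a subalgebra. This gives the uniqueness half of the
    universal property. *)
Lemma nualg_hom_unique (R : comPzRingType) (A B : nuAlgType R) (X : set A)
    (f g : A -> B) : generates X -> nualg_hom f -> nualg_hom g ->
  (forall x, X x -> f x = g x) -> f = g.
Proof.
move=> genX fh gh fgX; apply/funext.
apply: (generates_ind (B := [set x | f x = g x]) genX) => //.
split=> [|x y /= fx fy|c x /= fx|x y /= fx fy] /=.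
- by rewrite !nualg_hom0.
- by rewrite !nualg_homD ?fx ?fy.
- by rewrite !nualg_homZ ?fx.
- by rewrite !nualg_homM ?fx ?fy.
Qed.

(** * Linear spans *)

Section LinearSpan.
Variables (R : comPzRingType) (A : lmodType R).
Implicit Type X : set A.

Lemma linear_span0 X : linear_span X 0.
Proof.
exists 0, (fun=> 0), (fun=> 0); split=> [[]//|].
by rewrite big_ord0.
Qed.

Lemma linear_spanD X x y :
  linear_span X x -> linear_span X y -> linear_span X (x + y).
Proof.
move=> [m [c [u [uX ->]]]] [n [d [v [vX ->]]]].
exists (m + n)%N, (fun i => match fintype.split i with inl j => c j | inr j => d j end),
  (fun i => match fintype.split i with inl j => u j | inr j => v j end).
split; first by move=> i; case: fintype.split.
rewrite big_split_ord /=; congr (_ + _); apply: eq_bigr => i _.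
  by rewrite (unsplitK (inl i)).
by rewrite (unsplitK (inr i)).
Qed.

Lemma linear_spanZ X a x : linear_span X x -> linear_span X (a *: x).
Proof.
move=> [m [c [u [uX ->]]]]; exists m, (fun i => a * c i), u; split=> //.
by rewrite scaler_sumr; apply: eq_bigr => i _; rewrite scalerA.
Qed.

Lemma sub_linear_span X x : X x -> linear_span X x.
Proof.
move=> Xx; exists 1%N, (fun=> 1), (fun=> x); split=> //.
by rewrite big_ord1 scale1r.
Qed.

Lemma linear_span_sum X (I : Type) (r : seq I) (P : pred I) (F : I -> A) :
  (forall i, P i -> linear_span X (F i)) ->
  linear_span X (\sum_(i <- r | P i) F i).
Proof.
move=> FX; elim/big_rec: _ => [|i x Pi]; first exact: linear_span0.
by apply: linear_spanD; exact: FX.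
Qed.

Lemma linear_span_additive_subgroup X : is_additive_subgroup (linear_span X).
Proof.
split; first exact: linear_span0.
by move=> x y ? ?; rewrite -scaleN1r; apply/linear_spanD/linear_spanZ.
Qed.

End LinearSpan.

Lemma linear_span_mul (R : comPzRingType) (A : nuAlgType R) (X Y Z : set A) :
  (forall x y, X x -> Y y -> linear_span Z (x *~* y)) ->
  forall x y, linear_span X x -> linear_span Y y -> linear_span Z (x *~* y).
Proof.
move=> XYZ _ _ [m [c [u [uX ->]]]] [n [d [v [vX ->]]]].
rewrite numul_suml; apply: linear_span_sum => i _.
rewrite numul_sumr; apply: linear_span_sum => j _.
by rewrite -nuscaleAl -nuscaleAr; do 2!apply: linear_spanZ; exact: XYZ.
Qed.

(** * Quotients of modules *)

Section QuotientModule.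
Variables (R : comPzRingType) (M : lmodType R) (N : zmodClosed M).

Definition scale_closed := forall (c : R) x, x \in N -> c *: x \in N.

(** The type records the proof of closure under scaling, so that its module structure can be
    inferred from the type alone. *)
Definition quotient_module of scale_closed := Quotient.quot N.

Hypothesis N_scale : scale_closed.
Local Notation Q := (quotient_module N_scale).

HB.instance Definition _ := GRing.Zmodule.on Q.
HB.instance Definition _ : EqQuotient M (Quotient.equiv N) Q :=
  EqQuotient.on Q.

Definition quot_scale (c : R) : Q -> Q := lift_op1 Q ( *:%R c).

Lemma pi_quotD : {morph \pi_Q : x y / x + y >-> x + y}.
Proof. exact: (Quotient.pi_add N). Qed.

Lemma eq_pi_quot (x y : M) : (\pi_Q x = \pi_Q y) <-> (x - y \in N).
Proof. by rewrite (Quotient.idealrBE N); split=> [/eqP|/eqP]. Qed.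

Lemma pi_quotZ c : {morph \pi_Q : x / c *: x >-> quot_scale c x}.
Proof.
move=> x; unlock quot_scale; apply/eq_pi_quot; rewrite -scalerBr.
by apply/N_scale/eq_pi_quot; rewrite reprK.
Qed.

Fact quot_scalerA a b x : quot_scale a (quot_scale b x) = quot_scale (a * b) x.
Proof. by rewrite -[x]reprK -!pi_quotZ scalerA. Qed.

Fact quot_scale1r : left_id 1 quot_scale.
Proof. by move=> x; rewrite -[x]reprK -!pi_quotZ scale1r. Qed.

Fact quot_scalerDr : right_distributive quot_scale +%R.
Proof.
move=> a x y; rewrite -[x]reprK -[y]reprK -!pi_quotZ -!pi_quotD.
by rewrite -pi_quotZ scalerDr.
Qed.

Fact quot_scalerDl x : {morph quot_scale^~ x : a b / a + b}.
Proof.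
by move=> a b; rewrite -[x]reprK -!pi_quotZ -pi_quotD scalerDl.
Qed.

HB.instance Definition _ := GRing.Zmodule_isLmodule.Build R Q
  quot_scalerA quot_scale1r quot_scalerDr quot_scalerDl.

Lemma pi_quot_linear : linear (\pi_Q : M -> Q).
Proof. by move=> c x y; rewrite pi_quotD pi_quotZ. Qed.

End QuotientModule.

(** * The algebra of linear endomorphisms of a module *)

Section EndomorphismAlgebra.
Variables (R : comPzRingType) (M : lmodType R).

(** Being a boolean predicate closed under linear combinations, it makes [linear_endo] a submodule
    of the pointwise module [M -> M]. Both concrete Kumjian-Pask families below live in such
    endomorphism algebras. *)
Definition linear_endos : {pred M -> M} := fun f => `[< linear f >].

Fact linear_endos_submod : submod_closed linear_endos.
Proof.
split=> [|a f g /asboolP fl /asboolP gl]; apply/asboolP => c x y.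
  by rewrite scaler0 addr0.
have E z : (a *: f + g) z = a *: f z + g z by [].
rewrite !E (fl c x y) (gl c x y).
by rewrite !scalerDr !scalerA [a * c]mulrC addrACA.
Qed.

HB.instance Definition _ :=
  GRing.isSubmodClosed.Build R (M -> M) linear_endos linear_endos_submod.

Record linear_endo := LinearEndo {
  endo_fun :> M -> M;
  endo_funP : endo_fun \in linear_endos }.

HB.instance Definition _ := [isSub for endo_fun].
HB.instance Definition _ := [Choice of linear_endo by <:].
HB.instance Definition _ := [SubChoice_isSubLmodule of linear_endo by <:].

Lemma endo_linear (f : linear_endo) : linear f.
Proof. exact/asboolP/endo_funP. Qed.

Fact comp_linear_endo (f g : linear_endo) : f \o g \in linear_endos.
Proof. by apply/asboolP => c x y; rewrite /= !endo_linear. Qed.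

Definition endo_mul (f g : linear_endo) := LinearEndo (comp_linear_endo f g).

Lemma endo_ext (f g : linear_endo) : f =1 g -> f = g.
Proof. by move=> fg; apply: val_inj; apply/funext. Qed.

Lemma endoZ c (f : linear_endo) x : (c *: f) x = c *: f x.
Proof. by []. Qed.

Fact endo_mulA : associative endo_mul.
Proof. by move=> f g h; apply: endo_ext. Qed.

Fact endo_mulDl : left_distributive endo_mul +%R.
Proof. by move=> f g h; apply: endo_ext. Qed.

Fact endo_mulDr : right_distributive endo_mul +%R.
Proof.
move=> f g h; apply: endo_ext => x /=.
by have := endo_linear f 1 (g x) (h x); rewrite !scale1r.
Qed.

Fact endo_scaleAl c f g : c *: endo_mul f g = endo_mul (c *: f) g.
Proof. exact: endo_ext. Qed.

Fact endo_scaleAr c f g : c *: endo_mul f g = endo_mul f (c *: g).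
Proof.
apply: endo_ext => x /=; have := endo_linear f c (g x) 0.
have f0 : f 0 = 0.
  by have := endo_linear f (-1) 0 0; rewrite !scaleN1r oppr0 addr0 addNr.
by rewrite f0 !addr0.
Qed.

HB.instance Definition _ := Lmodule_isNuAlgebra.Build R linear_endo
  endo_mulA endo_mulDl endo_mulDr endo_scaleAl endo_scaleAr.

Lemma endoM (f g : linear_endo) x : (f *~* g) x = f (g x).
Proof. by []. Qed.

Lemma endo_sum (I : Type) (r : seq I) (P : pred I) (F : I -> linear_endo) x :
  (\sum_(i <- r | P i) F i) x = \sum_(i <- r | P i) F i x.
Proof. by apply: (big_morph (fun f : linear_endo => f x)). Qed.

End EndomorphismAlgebra.

(** * Algebras given by generators and relations *)

(* The algebra on the generators X subject to the relations valid in every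
   valuation satisfying K; it satisfies K itself as soon as K is equational. *)
Section Presentation.
Variables (R : comPzRingType) (X : Type).
Variable K : forall A : nuAlgType R, (X -> A) -> Prop.

Inductive term :=
  | TGen of X | TZero | TAdd of term & term | TScale of R & term
  | TMul of term & term.

HB.instance Definition _ := gen_eqMixin term.
HB.instance Definition _ := gen_choiceMixin term.

Fixpoint teval (A : nuAlgType R) (g : X -> A) (t : term) : A :=
  match t with
  | TGen x => g x
  | TZero => 0
  | TAdd t u => teval g t + teval g u
  | TScale c t => c *: teval g t
  | TMul t u => teval g t *~* teval g u
  end.

(** Since Prop is impredicative, quantifying over all algebras does not enlarge the universe of the
    quotient, which may thus itself be one of these algebras. *)
Definition term_equiv (t u : term) : bool :=
  `[< forall (A : nuAlgType R) (g : X -> A), K g -> teval g t = teval g u >].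

Fact term_equiv_class : equiv_class_of term_equiv.
Proof.
split=> [t|t u|u t v].
- exact/asboolP.
- by apply/asboolP/asboolP => tu A g Kg; rewrite tu.
- by move=> /asboolP tu /asboolP uv; apply/asboolP => A g Kg; rewrite tu ?uv.
Qed.

Canonical term_equiv_rel := EquivRelPack term_equiv_class.

Definition presented := {eq_quot term_equiv}.

HB.instance Definition _ := Choice.on presented.
HB.instance Definition _ : EqQuotient term term_equiv presented :=
  EqQuotient.on presented.

Definition plift (A : nuAlgType R) (g : X -> A) (x : presented) : A :=
  teval g (repr x).

Lemma plift_pi (A : nuAlgType R) (g : X -> A) (t : term) :
  K g -> plift g (\pi_presented t) = teval g t.
Proof.
move=> Kg; have /eqquotP/asboolP : repr (\pi_presented t) = t %[mod presented].
  by rewrite reprK.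
exact.
Qed.

(** Valuations satisfying [K] separate the elements, so each algebra axiom below is checked by
    evaluating both sides in an arbitrary algebra, where it already holds. *)
Lemma presented_ext (x y : presented) :
  (forall (A : nuAlgType R) (g : X -> A), K g -> plift g x = plift g y) -> x = y.
Proof. by move=> xy; rewrite -[x]reprK -[y]reprK; apply/eqquotP/asboolP. Qed.

Definition pgen x : presented := \pi_presented (TGen x).
Definition padd (x y : presented) : presented := \pi_presented (TAdd (repr x) (repr y)).
Definition pscale c (x : presented) : presented := \pi_presented (TScale c (repr x)).
Definition pmul (x y : presented) : presented := \pi_presented (TMul (repr x) (repr y)).
Definition pzero : presented := \pi_presented TZero.
Definition popp := pscale (-1).

Let pliftE A g (Kg : @K A g) :
  (forall x y, plift g (padd x y) = plift g x + plift g y) *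
  (forall c x, plift g (pscale c x) = c *: plift g x) *
  (forall x y, plift g (pmul x y) = plift g x *~* plift g y) *
  (plift g pzero = 0) * (forall t, plift g (\pi_presented t) = teval g t).
Proof. by do !split=> *; rewrite ?plift_pi. Qed.

Fact paddA : associative padd.
Proof. by move=> x y z; apply: presented_ext => A g /pliftE E;
  rewrite !E addrA. Qed.

Fact paddC : commutative padd.
Proof. by move=> x y; apply: presented_ext => A g /pliftE E;
  rewrite !E addrC. Qed.

Fact padd0 : left_id pzero padd.
Proof. by move=> x; apply: presented_ext => A g /pliftE E;
  rewrite !E add0r. Qed.

Fact paddN : left_inverse pzero popp padd.
Proof. by move=> x; apply: presented_ext => A g /pliftE E;
  rewrite !E scaleN1r addNr. Qed.

HB.instance Definition _ :=
  GRing.isZmodule.Build presented paddA paddC padd0 paddN.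

Fact pscaleA a b x : pscale a (pscale b x) = pscale (a * b) x.
Proof. by apply: presented_ext => A g /pliftE E;
  rewrite !E scalerA. Qed.

Fact pscale1 : left_id 1 pscale.
Proof. by move=> x; apply: presented_ext => A g /pliftE E;
  rewrite !E scale1r. Qed.

Fact pscaleDr : right_distributive pscale +%R.
Proof. by move=> a x y; apply: presented_ext => A g /pliftE E;
  rewrite !E scalerDr. Qed.

Fact pscaleDl x : {morph pscale^~ x : a b / a + b}.
Proof. by move=> a b; apply: presented_ext => A g /pliftE E;
  rewrite !E scalerDl. Qed.

HB.instance Definition _ := GRing.Zmodule_isLmodule.Build R presented
  pscaleA pscale1 pscaleDr pscaleDl.

Fact pmulA : associative pmul.
Proof. by move=> x y z; apply: presented_ext => A g /pliftE E;
  rewrite !E numulA. Qed.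

Fact pmulDl : left_distributive pmul +%R.
Proof. by move=> x y z; apply: presented_ext => A g /pliftE E;
  rewrite !E numulDl. Qed.

Fact pmulDr : right_distributive pmul +%R.
Proof. by move=> x y z; apply: presented_ext => A g /pliftE E;
  rewrite !E numulDr. Qed.

Fact pscaleAl c x y : c *: pmul x y = pmul (c *: x) y.
Proof. by apply: presented_ext => A g /pliftE E;
  rewrite !E nuscaleAl. Qed.

Fact pscaleAr c x y : c *: pmul x y = pmul x (c *: y).
Proof. by apply: presented_ext => A g /pliftE E;
  rewrite !E nuscaleAr. Qed.

HB.instance Definition _ := Lmodule_isNuAlgebra.Build R presented
  pmulA pmulDl pmulDr pscaleAl pscaleAr.

Lemma plift_hom (A : nuAlgType R) (g : X -> A) : K g -> nualg_hom (plift g).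
Proof.
move=> Kg; by have E := pliftE Kg; split=> [c x y|x y]; rewrite !E.
Qed.

Lemma plift_gen (A : nuAlgType R) (g : X -> A) x : K g -> plift g (pgen x) = g x.
Proof. exact: plift_pi. Qed.

Lemma pgen_generates : generates (range pgen).
Proof.
move=> B [B0 BD BZ BM] genB; apply/seteqP; split=> // x _.
rewrite -[x]reprK; elim: (repr x) => {x} [x||t Bt u Bu|c t Bt|t Bt u Bu].
- by apply: genB; exists x.
- exact: B0.
- have -> : \pi_presented (TAdd t u) = \pi_presented t + \pi_presented u.
    by apply: presented_ext => A g /pliftE E;
  rewrite !E.
  exact: BD.
- have -> : \pi_presented (TScale c t) = c *: \pi_presented t.
    by apply: presented_ext => A g /pliftE E;
  rewrite !E.
  exact: BZ.
have -> : \pi_presented (TMul t u) = \pi_presented t *~* \pi_presented u.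
  by apply: presented_ext => A g /pliftE E;
  rewrite !E.
exact: BM.
Qed.

End Presentation.

(** * Endomorphisms induced on a quotient module *)

Section QuotientEndomorphisms.
Variables (R : comPzRingType) (M : lmodType R) (N : zmodClosed M).
Hypothesis N_scale : scale_closed N.
Local Notation Q := (quotient_module N_scale).
Variable T : linear_endo M.
Hypothesis T_N : forall x, x \in N -> T x \in N.

Definition quot_endo_fun (x : Q) : Q := \pi_Q (T (repr x)).

Lemma quot_endo_funE x : quot_endo_fun (\pi_Q x) = \pi_Q (T x).
Proof.
apply/eq_pi_quot; have := endo_linear T (-1) x (repr (\pi_Q x)).
rewrite !scaleN1r ![- _ + _]addrC => <-.
by apply/T_N/eq_pi_quot; rewrite reprK.
Qed.

Fact quot_endo_linear : quot_endo_fun \in @linear_endos R Q.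
Proof.
apply/asboolP => c x y; rewrite -[x]reprK -[y]reprK -pi_quot_linear.
by rewrite !quot_endo_funE endo_linear pi_quot_linear.
Qed.

Definition quot_endo := LinearEndo quot_endo_linear.

Lemma quot_endoE x : quot_endo (\pi_Q x) = \pi_Q (T x).
Proof. exact: quot_endo_funE. Qed.

End QuotientEndomorphisms.

(** * Factorization and cancellation in k-graphs *)

Section KGraphTheory.
Variables (k : nat) (L : kgraph k).
Implicit Types (l m n : path L) (v : vertex L).

Lemma degree_addI (a b c : {ffun 'I_k -> nat}) : a + b = a + c -> b = c.
Proof.
by move=> /ffunP E; apply/ffunP => i; have := E i; rewrite !ffunE => /addnI.
Qed.

Lemma comp_factor l (a b : {ffun 'I_k -> nat}) : deg l = a + b ->
  exists p q, [/\ src p = rng q, deg p = a, deg q = b & l = comp p q].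
Proof. by move=> /factorization [[p q] [E _]]; exists p, q. Qed.

(** Degrees cancel, so the two pairs factor the same path with the same pair of degrees, and
    uniqueness of factorization applies. *)
Lemma comp_inj l m l' m' : src l = rng m -> src l' = rng m' ->
  deg l = deg l' -> comp l m = comp l' m' -> l = l' /\ m = m'.
Proof.
move=> lm lm' dl E.
have dm : deg m = deg m'.
  by apply: (@degree_addI (deg l)); rewrite -deg_comp// dl -deg_comp// E.
have [p [_ pU]] := factorization (deg_comp lm).
have /= := pU (l, m) (And4 lm erefl erefl erefl).
by have /= -> := pU (l', m') (And4 lm' (esym dl) (esym dm) E) => -[].
Qed.

(** When [l] has degree 0, composing it with the identity at its source or at its range gives two
    factorizations of [l] in degrees (0, 0), which must coincide. *)
Lemma deg0_idm l : deg l = 0 -> l = idm (rng l).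
Proof.
move=> dl; have [] // := @comp_inj l (idm (src l)) (idm (rng l)) l.
- by rewrite rng_idm.
- by rewrite src_idm.
- by rewrite deg_idm.
- by rewrite comp_idl comp_idr.
Qed.

Lemma deg_idm_eq0 v : (deg (idm v) != 0) = false.
Proof. by rewrite deg_idm eqxx. Qed.

Variant path_spec : path L -> Prop :=
  | PathIdm v : path_spec (idm v)
  | PathNz (l : nzpath L) : path_spec (val l).

Lemma pathP l : path_spec l.
Proof.
have [l0|l0] := eqVneq (deg l) 0; first by rewrite (deg0_idm l0); constructor.
by rewrite -[l]/(val (Sub l l0 : nzpath L)); constructor.
Qed.

Lemma deg_comp_eq0 l m : src l = rng m -> deg (comp l m) = 0 ->
  deg l = 0 /\ deg m = 0.
Proof.
move=> lm; rewrite deg_comp// => /ffunP E.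
by split; apply/ffunP => i; have := E i; rewrite !ffunE => /eqP;
   rewrite addn_eq0 => /andP[/eqP ? /eqP ?].
Qed.

End KGraphTheory.

(** * Kumjian-Pask families indexed by all paths *)

Section PathFamily.
Variables (k : nat) (L : kgraph k) (R : comPzRingType) (A : nuAlgType R).

(* A Kumjian-Pask family with the convention S_v = S_{v^*} = P_v built in,
   so that the relations do not single out the paths of degree 0. *)
Definition is_path_family (sr sg : path L -> A) : Prop :=
  [/\ forall l m, src l = rng m ->
        sr l *~* sr m = sr (comp l m) /\ sg m *~* sg l = sg (comp l m),
      forall v, sg (idm v) = sr (idm v),
      forall l m, deg l = deg m ->
        sg l *~* sr m = if l == m then sr (idm (src l)) else 0
    & forall v n, sr (idm v) = \sum_(l \in paths_from v n) (sr l *~* sg l)].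

Definition symbol_fun (sr sg : path L -> A) (x : symbol L) : A :=
  match x with Real l => sr (val l) | Ghost l => sg (val l) end.

Section FromPaths.
Variables sr sg : path L -> A.
Let P v := sr (idm v).
Let S := symbol_fun sr sg.

Lemma real_of_symbol_fun : real_of P S = sr.
Proof.
apply/funext => l; rewrite /real_of; case: insubP => [l' _ <-//|].
by rewrite negbK /P => /eqP /deg0_idm <-.
Qed.

Lemma ghost_of_symbol_fun :
  (forall v, sg (idm v) = sr (idm v)) -> ghost_of P S = sg.
Proof.
move=> sgr; apply/funext => l; rewrite /ghost_of; case: insubP => [l' _ <-//|].
by rewrite negbK /P -sgr => /eqP /deg0_idm <-.
Qed.

Lemma path_family_KP : is_path_family sr sg -> is_KP_family P S.
Proof.
move=> [sM sV sO sC]; split.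
(* Reading the left factor as a ghost turns a product of two vertex elements into the degree 0 case
   of the orthogonality relation. *)
- split=> [v|v w vw]; rewrite /P -{1}sV sO ?deg_idm// ?eqxx ?src_idm//.
  by case: eqP => // /(congr1 (@src _ _)); rewrite !src_idm.
- split=> [l m lm lmE E|l]; first by rewrite /S /= E; have [-> ->] := sM _ _ lmE.
  have rl : src (idm (rng (val l))) = rng (val l) by rewrite src_idm.
  have sl : src (val l) = rng (idm (src (val l))) by rewrite rng_idm.
  have [rM rM'] := sM _ _ rl; have [lM lM'] := sM _ _ sl.
  by rewrite /P /=; split; rewrite ?rM ?lM -?sV ?rM' ?lM' ?comp_idl ?comp_idr.
- by move=> l m /sO; rewrite /S /= => ->.
- move=> v n _; rewrite real_of_symbol_fun ghost_of_symbol_fun//; exact: sC.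
Qed.

End FromPaths.

Section ToPaths.
Variables (P : vertex L -> A) (S : symbol L -> A).
Local Notation sr := (real_of P S).
Local Notation sg := (ghost_of P S).

Lemma real_of_idm v : sr (idm v) = P v.
Proof. by rewrite /real_of insubF ?deg_idm_eq0// rng_idm. Qed.

Lemma ghost_of_idm v : sg (idm v) = P v.
Proof. by rewrite /ghost_of insubF ?deg_idm_eq0// rng_idm. Qed.

Lemma real_of_val (l : nzpath L) : sr (val l) = S (Real l).
Proof. by rewrite /real_of valK. Qed.

Lemma ghost_of_val (l : nzpath L) : sg (val l) = S (Ghost l).
Proof. by rewrite /ghost_of valK. Qed.

Lemma KP_path_family : is_KP_family P S -> is_path_family sr sg.
Proof.
move=> [[PI PO] [SM SP] SO SC]; split.
- move=> l m; case: (pathP l) => [v|{}l]; case: (pathP m) => [w|{}m].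
  + rewrite src_idm rng_idm => ->.
    have := comp_idl (idm w); rewrite rng_idm => ->.
    by rewrite !real_of_idm !ghost_of_idm PI.
  + rewrite src_idm => ->; rewrite comp_idl real_of_idm ghost_of_idm.
    by rewrite real_of_val ghost_of_val; have [] := SP m.
  + rewrite rng_idm => <-; rewrite comp_idr real_of_idm ghost_of_idm.
    by rewrite real_of_val ghost_of_val; have [] := SP l.
  + move=> lm; have lm0 : deg (comp (val l) (val m)) != 0.
      apply/eqP => /(deg_comp_eq0 lm)[/eqP l0 _].
      by have := valP l; rewrite /= l0.
    rewrite -[comp _ _]/(val (Sub (comp (val l) (val m)) lm0 : nzpath L)).
    by rewrite !real_of_val !ghost_of_val; apply: SM.
- by move=> v; rewrite real_of_idm ghost_of_idm.
- move=> l m; case: (pathP l) => [v|{}l]; case: (pathP m) => [w|{}m].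
  + move=> _; rewrite real_of_idm ghost_of_idm src_idm real_of_idm.
    case: eqP => [/(congr1 (@src _ _))|vw]; first by rewrite !src_idm => ->.
    by apply: PO => vw'; apply: vw; rewrite vw'.
  + by rewrite deg_idm => m0; have := valP m; rewrite /= -m0 eqxx.
  + by rewrite deg_idm => l0; have := valP l; rewrite /= l0 eqxx.
  + by move=> lm; rewrite real_of_val ghost_of_val SO// real_of_idm val_eqE.
(* In degree 0 the only path with range [v] is [idm v], and the sum relation amounts to idempotency
   of [P v]. *)
- move=> v n; have [->|n0] := eqVneq n 0; last first.
    by rewrite real_of_idm; exact: SC.
  rewrite (_ : paths_from v 0 = [set idm v]).
    by rewrite fsbig_set1 real_of_idm ghost_of_idm PI.
  apply/seteqP; split=> l /=; first by move=> [<- /deg0_idm].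
  by move=> ->; split; rewrite ?rng_idm ?deg_idm.
Qed.

End ToPaths.
End PathFamily.

(** * Products of monomials and their degrees *)

Section PathFamilyTheory.
Variables (k : nat) (L : kgraph k) (R : comPzRingType) (A : nuAlgType R).
Variables sr sg : path L -> A.
Hypothesis family : is_path_family sr sg.
Hypothesis L_row_finite : row_finite L.

Definition int_degree (l : path L) : {ffun 'I_k -> int} :=
  [ffun i => (deg l i)%:Z].

Lemma degree_diffE l m : degree_diff l m = int_degree l - int_degree m.
Proof. by apply/ffunP => i; rewrite !ffunE. Qed.

Lemma int_degree_comp l m :
  src l = rng m -> int_degree (comp l m) = int_degree l + int_degree m.
Proof.
by move=> lm; apply/ffunP => i; rewrite !ffunE deg_comp// ffunE PoszD.
Qed.

Lemma int_degree_idm v : int_degree (idm v) = 0.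
Proof. by apply/ffunP => i; rewrite !ffunE deg_idm ffunE. Qed.

Lemma eq_int_degree l m : deg l = deg m -> int_degree l = int_degree m.
Proof. by move=> lm; apply/ffunP => i; rewrite !ffunE lm. Qed.

Lemma real_idl l : sr (idm (rng l)) *~* sr l = sr l.
Proof.
by have [M _ _ _] := family; rewrite (M _ _ _).1 ?src_idm// comp_idl.
Qed.

Lemma real_idr l : sr l *~* sr (idm (src l)) = sr l.
Proof.
by have [M _ _ _] := family; rewrite (M _ _ _).1 ?rng_idm// comp_idr.
Qed.

Lemma ghost_idl l : sr (idm (src l)) *~* sg l = sg l.
Proof.
by have [M V _ _] := family; rewrite -V (M _ _ _).2 ?rng_idm// comp_idr.
Qed.

Lemma ghost_idr l : sg l *~* sr (idm (rng l)) = sg l.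
Proof.
by have [M V _ _] := family; rewrite -V (M _ _ _).2 ?src_idm// comp_idl.
Qed.

Lemma idm_orthogonal v w :
  sr (idm v) *~* sr (idm w) = if v == w then sr (idm v) else 0.
Proof.
have [_ V O _] := family; rewrite -{1}V O ?deg_idm// src_idm.
have [->|vw] := eqVneq v w; first by rewrite eqxx.
by case: eqP => // /(congr1 (@src _ _)) /eqP; rewrite !src_idm (negPf vw).
Qed.

(** If the paths do not compose, inserting the idempotents at the source of [l] and the range of [m]
    kills the product. *)
Lemma real_mul l m :
  sr l *~* sr m = if src l == rng m then sr (comp l m) else 0.
Proof.
have [M _ _ _] := family.
case: eqP => [lm|/eqP lm]; first by rewrite (M _ _ lm).1.
rewrite -real_idr -(real_idl m) numulA -(numulA (sr l)) idm_orthogonal.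
by rewrite (negPf lm) numul0r numul0l.
Qed.

Lemma ghost_mul l m :
  sg m *~* sg l = if src l == rng m then sg (comp l m) else 0.
Proof.
have [M _ _ _] := family.
case: eqP => [lm|/eqP lm]; first by rewrite (M _ _ lm).2.
rewrite -ghost_idr -(ghost_idl l) numulA -(numulA (sg m)) idm_orthogonal.
by rewrite eq_sym (negPf lm) numul0r numul0l.
Qed.

Lemma idm_sum v n :
  sr (idm v) = \sum_(l <- fset_set (paths_from v n)) sr l *~* sg l.
Proof. by have [_ _ _ C] := family; rewrite (C v n) fsbig_finite. Qed.

(** At [real_of P S] and [ghost_of P S] this is [KP_component P S] by conversion. *)
Definition path_component (n : {ffun 'I_k -> int}) : set A :=
  linear_span [set x | exists l m : path L,
    degree_diff l m = n /\ x = sr l *~* sg m].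

Lemma path_component_monomial l m n : degree_diff l m = n ->
  path_component n (sr l *~* sg m).
Proof. by move=> lm; apply: sub_linear_span; exists l, m. Qed.

(* Inserting the relation (KP4) for the degree d(l) + d(m) between s_{l^*} and
   s_m turns every summand into 0 or a monomial, because both l and m are then
   compared with initial segments of a path of larger degree. *)
Lemma ghost_real_component l m :
  path_component (degree_diff m l) (sg l *~* sr m).
Proof.
have [M V O _] := family.
rewrite -{1}(ghost_idr l) (idm_sum _ (deg l + deg m)) numul_sumr numul_suml.
rewrite big_seq; apply: linear_span_sum => nu.
rewrite in_fset_set// inE => -[_ dnu].
have [p [q [pq dp dq nuE]]] := comp_factor dnu.
have [p' [q' [pq' dp' dq' nuE']]] : exists p' q', [/\ src p' = rng q',
    deg p' = deg m, deg q' = deg l & nu = comp p' q'].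
  by apply: comp_factor; rewrite addrC.
rewrite !numulA {1}nuE -(M _ _ pq).1 nuE' -(M _ _ pq').2.
rewrite -!numulA (O p') ?dp'// !numulA O ?dp//.
case: eqP => [->|_]; last by rewrite !numul0l; apply: linear_span0.
rewrite pq real_idl; case: eqP => [_|_]; last first.
  by rewrite numul0r; apply: linear_span0.
rewrite pq' -numulA ghost_idr; apply: path_component_monomial.
by rewrite !degree_diffE (eq_int_degree dp) (eq_int_degree dq) (eq_int_degree dq').
Qed.

(** In a product of two monomials the inner factor, a ghost times a real path, is a combination of
    monomials by [ghost_real_component]. The outer real path is then absorbed on the left ([realL])
    and the outer ghost on the right ([ghostR]), each shifting the degree. *)
Lemma path_component_mul m n x y :
  path_component m x -> path_component n y -> path_component (m + n) (x *~* y).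
Proof.
apply: linear_span_mul => {}x {}y [l [l' [<- ->]]] [q' [q [<- ->]]].
rewrite -numulA (numulA (sg l')).

have realL z : path_component (degree_diff q' l') z ->
    path_component (degree_diff q' l' + int_degree l) (sr l *~* z).
  apply: (@linear_span_mul _ _ [set sr l]) (sub_linear_span _) => //.
  move=> _ {}z -> [a [b [ab ->]]].
  rewrite numulA real_mul; case: eqP => [la|_]; last first.
    by rewrite numul0l; apply: linear_span0.
  apply: path_component_monomial; rewrite -ab !degree_diffE int_degree_comp//.
  by rewrite [RHS]addrAC (addrC (int_degree a)).
have ghostR z : path_component (degree_diff q' l' + int_degree l) z ->
    path_component (degree_diff q' l' + int_degree l - int_degree q) (z *~* sg q).
  move/(@linear_span_mul _ _ _ [set sg q]); apply; last exact: sub_linear_span.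
  move=> {}z _ [a [b [ab ->]]] ->.
  rewrite -numulA ghost_mul; case: eqP => [lb|_]; last first.
    by rewrite numul0r; apply: linear_span0.
  apply: path_component_monomial; rewrite -ab !degree_diffE int_degree_comp//.
  by rewrite opprD addrA addrAC.
rewrite (_ : _ + degree_diff _ _ = degree_diff q' l' + int_degree l - int_degree q).
  by rewrite numulA; apply/ghostR/realL/ghost_real_component.
by rewrite !degree_diffE addrA; congr (_ - _); rewrite addrC addrA addrAC.
Qed.

End PathFamilyTheory.

(** * Shift operators on functions with values in an algebra *)

Section ShiftAlgebra.
Variables (R : comPzRingType) (A : nuAlgType R) (Z : zmodType).

(** This is convolution by the element $x t^n$ of the group ring of [Z] with coefficients in [A]. *)
Definition shift_fun (n : Z) (x : A) (g : Z -> A) : Z -> A :=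
  fun j => x *~* g (j - n).

Fact shift_linear n x : shift_fun n x \in @linear_endos R (Z -> A).
Proof.
apply/asboolP => c f g; apply/funext => j.
have E (u v : Z -> A) i : (c *: u + v) i = c *: u i + v i by [].
by rewrite E /shift_fun E numulDr nuscaleAr.
Qed.

Definition shift n x := LinearEndo (shift_linear n x).

Lemma shiftM m n x y : shift m x *~* shift n y = shift (m + n) (x *~* y).
Proof.
apply: endo_ext => g; apply/funext => j.
by rewrite endoM /= /shift_fun -numulA opprD addrA.
Qed.

Lemma shift_is_linear n : linear (shift n).
Proof.
move=> c x y; apply: endo_ext => g; apply/funext => j.
by rewrite /= /shift_fun numulDl -nuscaleAl.
Qed.

Lemma shift0 n : shift n 0 = 0.
Proof. by apply: endo_ext => g; apply/funext => j; exact: numul0l. Qed.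

Lemma shift_sum n (I : Type) (r : seq I) (P : pred I) (F : I -> A) :
  shift n (\sum_(i <- r | P i) F i) = \sum_(i <- r | P i) shift n (F i).
Proof.
apply: (big_morph (shift n)) => [x y|]; last exact: shift0.
by have := shift_is_linear n 1 x y; rewrite !scale1r.
Qed.

End ShiftAlgebra.

(** * The grading by degree differences *)

Section Grading.
Variables (k : nat) (L : kgraph k) (R : comPzRingType) (A : nuAlgType R).
Variables sr sg : path L -> A.
Hypothesis family : is_path_family sr sg.
Hypothesis L_row_finite : row_finite L.

(** Each relation is homogeneous when $s_l$ has weight $d(l)$ and $s_{l^*}$ has weight $-d(l)$, so
    it survives the shifts. By universality this yields the homomorphism [D] assumed below. *)
Lemma shift_path_family : is_path_family
  (fun l => shift (int_degree l) (sr l)) (fun l => shift (- int_degree l) (sg l)).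
Proof.
have [M V O C] := family; split.
- move=> l m lm; have [rM gM] := M _ _ lm.
  by rewrite !shiftM rM gM int_degree_comp// opprD (addrC (- int_degree m)).
- by move=> v; rewrite int_degree_idm oppr0 V.
- move=> l m lm; rewrite shiftM O// (eq_int_degree lm) addNr int_degree_idm.
  by case: eqP => // _; exact: shift0.
- move=> v n; rewrite int_degree_idm (idm_sum family L_row_finite v n) shift_sum.
  rewrite fsbig_finite//; apply: eq_bigr => l _.
  by rewrite shiftM subrr.
Qed.

Variable D : A -> linear_endo ({ffun 'I_k -> int} -> A).
Hypothesis D_hom : nualg_hom D.
Hypothesis D_real : forall l, D (sr l) = shift (int_degree l) (sr l).
Hypothesis D_ghost : forall l, D (sg l) = shift (- int_degree l) (sg l).
Hypothesis spanned : forall x,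
  linear_span [set y | exists l m, y = sr l *~* sg m] x.

Lemma shift_path_component n x : path_component sr sg n x -> D x = shift n x.
Proof.
move=> [j [c [y [yE ->]]]].
rewrite (nualg_hom_sum D_hom) shift_sum; apply: eq_bigr => i _.
rewrite (nualg_homZ D_hom); have [l [m [<- ->]]] := yE i.
rewrite (nualg_homM D_hom) D_real D_ghost shiftM -(degree_diffE l m).
by have := @shift_is_linear R A _ (degree_diff l m) (c i) (sr l *~* sg m) 0;
   rewrite shift0 !addr0.
Qed.

(** The sum of the distinct vertex idempotents at the ranges of the ghost paths occurring in [x] is
    a right unit for [x]. Removing duplicates matters: each idempotent has to occur exactly once. *)
Lemma right_faithful (x : A) : (forall y : A, x *~* y = 0) -> x = 0.
Proof.
have [n [c [y [yE xE]]]] := spanned x; move=> x0.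
have [f fE] := choice yE; have {fE} [g fE] := choice fE.
pose ws := undup [seq rng (g i) | i <- enum 'I_n].
suff <- : x *~* \sum_(v <- ws) sr (idm v) = x by rewrite x0.
rewrite {1}xE numul_suml xE; apply: eq_bigr => i _.
rewrite -nuscaleAl; congr (_ *: _); rewrite fE -numulA; congr (_ *~* _).
have iws : rng (g i) \in ws.
  by rewrite mem_undup; apply/mapP; exists i; rewrite ?mem_enum.
rewrite (bigD1_seq (rng (g i))) ?undup_uniq//= numulDr (ghost_idr family).
rewrite numul_sumr big1 ?addr0// => v vi.
by rewrite -(ghost_idr family) -numulA (idm_orthogonal family) eq_sym (negPf vi) numul0r.
Qed.

(** The right-hand side depends only on [a], [n] and [u], not on the decomposition [f]; this is the
    source of uniqueness in the grading. *)
Lemma path_component_coord (f : {ffun 'I_k -> int} -> A) (a : A) n (u : A) :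
  (forall n, path_component sr sg n (f n)) ->
  finite_set [set n | f n != 0] ->
  a = \sum_(n \in [set: {ffun 'I_k -> int}]) f n ->
  f n *~* u = D a (fun j => if j == 0 then u else 0) n.
Proof.
move=> fC ffin ->.
rewrite (fsbigTE (fset_set [set n | f n != 0])); last first.
  by move=> i; rewrite in_fset_set// notin_setE /= => /negP; rewrite negbK => /eqP.
rewrite (nualg_hom_sum D_hom) endo_sum.
rewrite (eq_bigr (fun i => shift i (f i) (fun j => if j == 0 then u else 0))); last first.
  by move=> i _; rewrite (shift_path_component (fC i)).
rewrite fct_sumE /= /shift_fun.
have [nf|nf] := boolP (n \in fset_set [set n | f n != 0]).
  rewrite (bigD1_seq n) ?fset_uniq//= subrr eqxx big1 ?addr0// => i ni.
  by rewrite subr_eq0 eq_sym (negPf ni) numul0r.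
rewrite big1_seq => [|i /= iS].
  move: nf; rewrite in_fset_set// notin_setE /= => /negP; rewrite negbK => /eqP ->.
  exact: numul0l.
rewrite subr_eq0; case: eqP => [ni|_]; last exact: numul0r.
by rewrite ni iS in nf.
Qed.

Lemma path_component_grading : is_grading (path_component sr sg).
Proof.
split.
- by move=> n; apply: linear_span_additive_subgroup.
- by move=> m n x y; apply: path_component_mul.
move=> a; have [n [c [y [yE aE]]]] := spanned a.
have [l lE] := choice yE; have {lE} [m lmE] := choice lE.
(* Existence: collect the monomials of [a] by degree; [r] lists the finitely many degrees that
   occur. *)
pose dd i := degree_diff (l i) (m i).
pose f d := \sum_(i | dd i == d) c i *: y i.
have fC d : path_component sr sg d (f d).
  apply: linear_span_sum => i /eqP <-; apply: linear_spanZ.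
  by rewrite lmE; apply: path_component_monomial.
pose r := undup [seq dd i | i <- enum 'I_n].
have f0 d : d \notin r -> f d = 0.
  move=> dr; apply: big1 => i /eqP di; case/negP: dr.
  by rewrite mem_undup; apply/mapP; exists i; rewrite ?mem_enum.
have fr : [set d | f d != 0] `<=` [set` r].
  by move=> d /=; apply: contraNT => /f0 ->.
have ffin : finite_set [set d | f d != 0].
  by apply: sub_finite_set fr _; apply: finite_seq.
have fa : a = \sum_(d \in [set: {ffun 'I_k -> int}]) f d.
  rewrite (fsbigE r) ?undup_uniq//; last by move=> d _ /f0.
  rewrite (eq_bigl xpredT) => [|d]; last by rewrite in_setT.
  (* After the sums are exchanged, the monomial of index [i] contributes only in degree [dd i]. *)
  rewrite aE /f (exchange_big_dep xpredT)//=; apply: eq_bigr => i _.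
  rewrite big_mkcond (bigD1_seq (dd i)) ?undup_uniq//=; last first.
    by rewrite mem_undup; apply/mapP; exists i; rewrite ?mem_enum.
  by rewrite eqxx big1 ?addr0// => d; rewrite eq_sym => /negPf ->.
exists f; split=> // f' [f'C f'fin f'a]; apply/funext => d.
(* Uniqueness: in each degree the two candidates have the same product with every [u]. *)
apply/eqP; rewrite -subr_eq0; apply/eqP/right_faithful => u.
rewrite numulBl (path_component_coord _ _ fC ffin fa).
by rewrite (path_component_coord _ _ f'C f'fin f'a) subrr.
Qed.

End Grading.

(** * Left division of paths *)

Lemma eq_option (T : Type) (a b : option T) :
  (forall t, a = Some t <-> b = Some t) -> a = b.
Proof.
case: a => [t|] ab; first by apply/esym/ab.
by case: b ab => // t /(_ t) [_ /(_ erefl)].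
Qed.

Section PathQuotient.
Variables (k : nat) (L : kgraph k).
Implicit Types (l m x y z : path L) (v : vertex L).

(** The tail of [y] after the initial segment [l], if there is one. It is picked by choice, and
    unique factorization makes it canonical in [path_quoP]. *)
Definition path_quo l y : option (path L) :=
  if pselect (exists z, src l = rng z /\ y = comp l z) is left e
  then Some (projT1 (cid e)) else None.

Lemma path_quoP l y z :
  path_quo l y = Some z <-> src l = rng z /\ y = comp l z.
Proof.
rewrite /path_quo; case: pselect => [e|ne]; last first.
  by split=> // E; case: ne; exists z.
case: (cid e) => z' [lz' yE] /=; split=> [[<-] //|[lz yE']].
by have [] := comp_inj lz' lz erefl; rewrite -?yE -?yE'// => _ ->.
Qed.

Lemma path_quo_comp l m y : src l = rng m ->
  path_quo (comp l m) y = obind (path_quo m) (path_quo l y).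
Proof.
move=> lm; apply: eq_option => z; split.
  move=> /path_quoP []; rewrite src_comp// => mz ->.
  have /path_quoP -> /= : src l = rng (comp m z) /\
      comp (comp l m) z = comp l (comp m z).
    by rewrite rng_comp// Defs.compA.
  exact/path_quoP.
case E: (path_quo l y) => [w|//] /= /path_quoP [mz wE].
have [lw yE] := (path_quoP l y w).1 E.
by apply/path_quoP; rewrite src_comp// -Defs.compA// -wE.
Qed.

Lemma path_quo_idm v y : path_quo (idm v) y = if rng y == v then Some y else None.
Proof.
apply: eq_option => z; split.
  by move=> /path_quoP []; rewrite src_idm => -> ->; rewrite comp_idl eqxx.
by case: eqP => // <- [<-]; apply/path_quoP; rewrite src_idm comp_idl.
Qed.

Lemma path_quo_compl l m x : src l = rng x -> deg l = deg m ->
  path_quo m (comp l x) = if l == m then Some x else None.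
Proof.
move=> lx lm; apply: eq_option => z; split.
  by move=> /path_quoP [mz /(comp_inj lx mz lm) [-> ->]]; rewrite eqxx.
by case: eqP => // <- [<-]; apply/path_quoP.
Qed.

End PathQuotient.

(** * The action on germs at infinity *)

Section GermModel.
Variables (k : nat) (L : kgraph k) (R : comPzRingType).
Hypothesis L_row_finite : row_finite L.
Hypothesis L_no_sources : no_sources L.
Local Notation M := (path L -> R^o).

Definition above (n : {ffun 'I_k -> nat}) (l : path L) :=
  forall i, (n i <= deg l i)%N.

Definition eventually_zero : {pred M} :=
  fun f => `[< exists n, forall l, above n l -> f l = 0 >].

Fact eventually_zero_zmod : zmod_closed eventually_zero.
Proof.
split=> [|f g /asboolP [m fm] /asboolP [n gn]]; apply/asboolP; first by exists 0.
exists (m + n) => l mnl; rewrite -[LHS]/(f l - g l) fm ?gn ?subrr// => i;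
  have := mnl i; rewrite ffunE => /(leq_trans _) -> //.
  exact: leq_addl.
exact: leq_addr.
Qed.

HB.instance Definition _ :=
  GRing.isZmodClosed.Build M eventually_zero eventually_zero_zmod.

Fact eventually_zero_scale : @scale_closed R _ eventually_zero.
Proof.
move=> c f /asboolP [n fn]; apply/asboolP; exists n => l /fn fl.
by rewrite -[LHS]/(c *: f l) fl scaler0.
Qed.

(* Germs at infinity of functions on paths: they replace functions on infinite
   paths, on which s_l acts by f |-> (y |-> f(z) if y = lz, and 0 otherwise). *)
Definition germ := quotient_module eventually_zero_scale.

Definition real_fun (l : path L) (f : M) : M :=
  fun y => oapp f 0 (path_quo l y).

Definition ghost_fun (l : path L) (f : M) : M :=
  fun x => if rng x == src l then f (comp l x) else 0.

Fact real_fun_linear l : real_fun l \in @linear_endos R M.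
Proof.
apply/asboolP => c f g; apply/funext => y.
have E (u w : M) z : (c *: u + w) z = c *: u z + w z by [].
rewrite E /real_fun; case: path_quo => [z|] /=; first exact: E.
by rewrite scaler0 addr0.
Qed.

Fact ghost_fun_linear l : ghost_fun l \in @linear_endos R M.
Proof.
apply/asboolP => c f g; apply/funext => y.
have E (u w : M) z : (c *: u + w) z = c *: u z + w z by [].
rewrite E /ghost_fun; case: ifP => _; first exact: E.
by rewrite scaler0 addr0.
Qed.

Fact real_fun_eventually l f :
  f \in eventually_zero -> LinearEndo (real_fun_linear l) f \in eventually_zero.
Proof.
(* Removing [l] from a path lowers its degree by [deg l], so the bound for [f] rises by that
   amount. *)
move=> /asboolP [n fn]; apply/asboolP; exists (n + deg l) => y ny /=.
rewrite /real_fun; case E: (path_quo l y) => [z|//] /=; apply: fn => i.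
have [lz yE] := (path_quoP l y z).1 E.
by have := ny i; rewrite yE deg_comp// !ffunE [_ + deg z i]addrC leq_add2r.
Qed.

Fact ghost_fun_eventually l f :
  f \in eventually_zero -> LinearEndo (ghost_fun_linear l) f \in eventually_zero.
Proof.
move=> /asboolP [n fn]; apply/asboolP; exists n => x nx /=.
rewrite /ghost_fun; case: eqP => // /esym lx; apply: fn => i.
by rewrite deg_comp// ffunE (leq_trans (nx i))// leq_addl.
Qed.

Definition germ_real l : linear_endo germ :=
  quot_endo eventually_zero_scale (@real_fun_eventually l).

Definition germ_ghost l : linear_endo germ :=
  quot_endo eventually_zero_scale (@ghost_fun_eventually l).

Lemma germ_realE l f : germ_real l (\pi_germ f) = \pi_germ (real_fun l f).
Proof. exact: quot_endoE. Qed.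

Lemma germ_ghostE l f : germ_ghost l (\pi_germ f) = \pi_germ (ghost_fun l f).
Proof. exact: quot_endoE. Qed.

Lemma germ_endo_ext (S T : linear_endo germ) :
  (forall f, S (\pi_germ f) = T (\pi_germ f)) -> S = T.
Proof. by move=> ST; apply: endo_ext => x; rewrite -[x]reprK ST. Qed.

Lemma real_ghost_fun l f y :
  real_fun l (ghost_fun l f) y = if path_quo l y then f y else 0.
Proof.
rewrite /real_fun; case E: (path_quo l y) => [z|//] /=.
by have [lz ->] := (path_quoP l y z).1 E; rewrite /ghost_fun lz eqxx.
Qed.

(** A path [y] of degree at least [n] has exactly one initial segment [p] of degree [n], so at most
    the summand [l = p] survives. For other [y] with range [v] all summands vanish although [f y]
    need not, whence the passage to germs. *)
Lemma real_ghost_fun_sum v n f y : above n y ->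
  \sum_(l <- fset_set (paths_from v n)) real_fun l (ghost_fun l f) y =
  real_fun (idm v) f y.
Proof.
move=> ny; rewrite {2}/real_fun path_quo_idm.
under eq_bigr do rewrite real_ghost_fun.
have [p [q [pq dp dq yE]]] : exists p q, [/\ src p = rng q, deg p = n,
    deg q = [ffun i => (deg y i - n i)%N] & y = comp p q].
  apply: comp_factor; apply/ffunP => i; rewrite !ffunE.
  exact/esym/subnKC.
have quo l : l \in fset_set (paths_from v n) -> path_quo l y -> rng y = v /\ l = p.
  rewrite in_fset_set// inE => -[rl dl].
  case E: (path_quo l y) => [z|//] _.
  have [lz yE'] := (path_quoP l y z).1 E; rewrite {1}yE' rng_comp//; split=> //.
  by have [] // := comp_inj lz pq; rewrite ?dl ?dp -?yE -?yE'.
case: eqP => [ry|ry] /=; last first.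
  by rewrite big1_seq// => l /= /quo; case: (path_quo l y) => [z /(_ isT) []|].
have pS : p \in fset_set (paths_from v n).
  by rewrite in_fset_set// inE; split=> //; rewrite -ry yE rng_comp.
have /path_quoP E : src p = rng q /\ y = comp p q by [].
rewrite (bigD1_seq p) ?fset_uniq//= E big1_seq ?addr0// => l /andP[lp /quo].
by case: (path_quo l y) lp => [z|//] /eqP lp /(_ isT) [].
Qed.

Lemma germ_path_family : is_path_family germ_real germ_ghost.
Proof.
split.
- move=> l m lm; split; apply: germ_endo_ext => f.
    rewrite endoM !germ_realE; congr (\pi_germ _); apply/funext => y.
    by rewrite /real_fun path_quo_comp//; case: (path_quo l y).
  rewrite endoM !germ_ghostE; congr (\pi_germ _); apply/funext => x.
  rewrite /ghost_fun src_comp//; case: eqP => // xm.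
  by rewrite rng_comp// lm eqxx Defs.compA.
- move=> v; apply: germ_endo_ext => f; rewrite germ_realE germ_ghostE.
  congr (\pi_germ _); apply/funext => x.
  rewrite /ghost_fun /real_fun path_quo_idm src_idm.
  by case: eqP => //= <-; rewrite comp_idl.
- move=> l m lm; apply: germ_endo_ext => f.
  rewrite endoM germ_realE germ_ghostE.
  have -> : ghost_fun l (real_fun m f) =
      if l == m then real_fun (idm (src l)) f else 0.
    apply/funext => x; rewrite /ghost_fun /real_fun.
    case: (eqVneq (rng x) (src l)) => [xl|xl].
      rewrite path_quo_compl//; case: eqP => // _.
      by rewrite path_quo_idm xl eqxx.
    by case: ifP => // _; rewrite path_quo_idm (negPf xl).
  by case: eqP => _; rewrite ?germ_realE// -[RHS]/(0 : germ) raddf0.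
(* The first three relations hold exactly for functions; this one holds only on paths of degree at
   least [n], hence modulo [eventually_zero]. *)
- move=> v n; apply: germ_endo_ext => f.
  rewrite fsbig_finite// endo_sum germ_realE.
  under eq_bigr do rewrite endoM germ_ghostE germ_realE.
  have <- : \pi_germ (\sum_(l <- fset_set (paths_from v n))
      real_fun l (ghost_fun l f)) = \sum_(l <- fset_set (paths_from v n))
      \pi_germ (real_fun l (ghost_fun l f)) :> germ.
    apply: (big_morph (\pi_germ : M -> germ)) => [g h|]; last exact: raddf0.
    exact: pi_quotD.
  apply/eq_pi_quot/asboolP; exists n => y ny.
  rewrite -[LHS]/(_ y - _ y) fct_sumE real_ghost_fun_sum// subrr//.
Qed.

Lemma germ_idm_neq0 v (r : R) : r != 0 -> r *: germ_real (idm v) != 0.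
Proof.
move=> r0; apply: contra r0 => /eqP E.
have : (r *: germ_real (idm v)) (\pi_germ (fun=> 1)) = 0 by rewrite E.
rewrite endoZ germ_realE -[_ *: _]pi_quotZ => /eqP.
rewrite -(raddf0 \pi_germ) => /eqP /eq_pi_quot /asboolP [n].
(* The germ being zero, its representative vanishes on all paths above some [n]. Absence of sources
   supplies a path of degree [n] with range [v], where the value is [r]. *)
have [l [rl dl]] := L_no_sources v n.
have nl : above n l by rewrite /above dl.
move=> /(_ l nl); rewrite subr0 -[X in X = 0]/(r * real_fun (idm v) (fun=> 1) l).
by rewrite /real_fun path_quo_idm rl eqxx /= mulr1 => ->.
Qed.

End GermModel.

(** * The universal family and its properties *)

Section FamilyMorphisms.
Variables (k : nat) (L : kgraph k) (R : comPzRingType) (A B : nuAlgType R).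
Variables (P : vertex L -> A) (S : symbol L -> A).
Variables (Q : vertex L -> B) (T : symbol L -> B) (f : A -> B).
Hypothesis fP : forall v, f (P v) = Q v.
Hypothesis fS : forall x, f (S x) = T x.

Lemma real_of_morph l : f (real_of P S l) = real_of Q T l.
Proof. by rewrite /real_of; case: insub => *; rewrite ?fP ?fS. Qed.

Lemma ghost_of_morph l : f (ghost_of P S l) = ghost_of Q T l.
Proof. by rewrite /ghost_of; case: insub => *; rewrite ?fP ?fS. Qed.

End FamilyMorphisms.

(** The span of the monomials is closed under products by [path_component_mul], once degrees are
    forgotten. It contains the generators because multiplying by vertex idempotents turns each of
    them into a monomial. *)
Lemma KP_family_spans (k : nat) (L : kgraph k) (R : comPzRingType)
    (A : nuAlgType R) (P : vertex L -> A) (S : symbol L -> A) :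
  row_finite L -> is_KP_family P S -> generates (generator_set P S) ->
  forall x, linear_span
    [set y | exists l m, y = real_of P S l *~* ghost_of P S m] x.
Proof.
move=> Lf /KP_path_family F gen; apply: (generates_ind gen).
  split=> [|x y|c x|]; [exact: linear_span0|exact: linear_spanD|
    exact: linear_spanZ|].
  apply: linear_span_mul => x y [l [m ->]] [l' [m' ->]].
  have := path_component_mul F Lf (path_component_monomial _ _ erefl)
    (path_component_monomial _ _ erefl).
  move=> /(_ l m l' m') [n [c [z [zE ->]]]]; exists n, c, z; split=> // i.
  by have [a [b [_ ->]]] := zE i; exists a, b.
move=> _ [[v _ <-]|[[l|l] _ <-]]; apply: sub_linear_span.
- exists (idm v), (idm v).
  have := idm_orthogonal F v v.
  by rewrite eqxx ghost_of_idm !real_of_idm => ->.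
- exists (val l), (idm (src (val l))).
  have [_ V _ _] := F; rewrite V -(real_of_val P S); exact/esym/(real_idr F).
- exists (idm (src (val l))), (val l).
  by rewrite -(ghost_of_val P S); exact/esym/(ghost_idl F).
Qed.

Section UniversalFamily.
Variables (k : nat) (L : kgraph k) (R : comPzRingType).
Hypothesis L_row_finite : row_finite L.

(** The two functions of a family are merged into one on a sum type, to fit the general
    presentation. *)
Definition is_KP_valuation (A : nuAlgType R) (g : vertex L + symbol L -> A) :=
  is_KP_family (g \o inl) (g \o inr).

Definition KP_algebra := presented is_KP_valuation.

Definition KP_vertex v : KP_algebra := pgen is_KP_valuation (inl v).
Definition KP_symbol x : KP_algebra := pgen is_KP_valuation (inr x).

(** Each relation is an equation, so [presented_ext] reduces it to the same relation in an arbitrary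
    family. For (KP4), row-finiteness gives a finite sum, which the evaluation homomorphisms
    preserve. *)
Lemma KP_universal_family : is_KP_family KP_vertex KP_symbol.
Proof.
have homM (A : nuAlgType R) g (Kg : @is_KP_valuation A g) := nualg_homM (plift_hom Kg).
have vE (A : nuAlgType R) g (Kg : @is_KP_valuation A g) v :
  plift g (KP_vertex v) = (g \o inl) v by exact: plift_gen.
have sE (A : nuAlgType R) g (Kg : @is_KP_valuation A g) x :
  plift g (KP_symbol x) = (g \o inr) x by exact: plift_gen.
split.
- split=> [v|v w vw]; apply: presented_ext => A g Kg; have [[I O] _ _ _] := Kg.
    by rewrite homM// vE// I.
  by rewrite homM// !vE// O// (nualg_hom0 (plift_hom Kg)).
- split=> [l m lm lE E|l].
    by split; apply: presented_ext => A g Kg; have [_ [M _] _ _] := Kg;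
      rewrite homM// !sE//; have [] := M _ _ _ lE E.
  by split; apply: presented_ext => A g Kg; have [_ [_ M] _ _] := Kg;
    rewrite homM// !sE// !vE//; have [] := M l.
- move=> l m lm; apply: presented_ext => A g Kg; have [_ _ O _] := Kg.
  rewrite homM// !sE// O//; case: eqP => _; first by rewrite vE.
  by rewrite (nualg_hom0 (plift_hom Kg)).
- move=> v n n0; rewrite fsbig_finite//; apply: presented_ext => A g Kg.
  have [_ _ _ C] := Kg.
  rewrite vE// (C v n n0) fsbig_finite// (nualg_hom_sum (plift_hom Kg)).
  apply: eq_bigr => l _; rewrite homM//.
  by rewrite (real_of_morph (vE _ _ Kg) (sE _ _ Kg)) (ghost_of_morph (vE _ _ Kg) (sE _ _ Kg)).
Qed.

Lemma KP_generates : generates (generator_set KP_vertex KP_symbol).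
Proof.
move=> B Bsub Bgen; apply: pgen_generates => // _ [[v|x] _ <-]; apply: Bgen.
  by left; exists v.
by right; exists x.
Qed.

Lemma KP_lift (A : nuAlgType R) (Q : vertex L -> A) (T : symbol L -> A) :
  is_KP_family Q T -> exists pi : KP_algebra -> A,
    [/\ nualg_hom pi, forall v, pi (KP_vertex v) = Q v
      & forall x, pi (KP_symbol x) = T x].
Proof.
move=> QT; pose g x := match x with inl v => Q v | inr x => T x end.
have Kg : is_KP_valuation g by [].
exists (plift g); split; first exact: plift_hom.
  by move=> v; rewrite /KP_vertex plift_gen.
by move=> x; rewrite /KP_symbol plift_gen.
Qed.

Lemma KP_lift_paths (A : nuAlgType R) (sr sg : path L -> A) :
  is_path_family sr sg -> exists pi : KP_algebra -> A, [/\ nualg_hom pi,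
    forall l, pi (real_of KP_vertex KP_symbol l) = sr l
  & forall l, pi (ghost_of KP_vertex KP_symbol l) = sg l].
Proof.
move=> F; have [pi [pi_hom piv pis]] := KP_lift (path_family_KP F).
exists pi; split=> // l.
  by rewrite (real_of_morph piv pis) real_of_symbol_fun.
by rewrite (ghost_of_morph piv pis) ghost_of_symbol_fun//; have [] := F.
Qed.

Lemma KP_grading : is_grading (KP_component KP_vertex KP_symbol).
Proof.
have F := KP_path_family KP_universal_family.
have [D [D_hom Dr Dg]] := KP_lift_paths (shift_path_family F L_row_finite).
apply: (path_component_grading F L_row_finite D_hom Dr Dg).
exact: KP_family_spans L_row_finite KP_universal_family KP_generates.
Qed.

Lemma KP_vertex_neq0 v (r : R) :
  no_sources L -> r != 0 -> r *: KP_vertex v != 0.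
Proof.
move=> Ls r0.
have [D [D_hom Dr _]] := KP_lift_paths (germ_path_family R L_row_finite).
have := germ_idm_neq0 Ls v r0; apply: contraNneq => E.
by rewrite -Dr real_of_idm -(nualg_homZ D_hom) E (nualg_hom0 D_hom).
Qed.

End UniversalFamily.

Theorem theorem3p4 (k : nat) (k_gt0 : (0 < k)%N) (L : kgraph k)
    (L_row_finite : row_finite L) (L_no_sources : no_sources L)
    (R : comPzRingType) :
  exists (KP : nuAlgType R) (p : vertex L -> KP) (s : symbol L -> KP),
    [/\ is_KP_family p s,
        generates (generator_set p s),
        forall (A : nuAlgType R) (Q : vertex L -> A) (T : symbol L -> A),
          is_KP_family Q T ->
          exists! pi : KP -> A,
            [/\ nualg_hom pi,
                forall v : vertex L, pi (p v) = Q v,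
                forall l : nzpath L, pi (s (Real l)) = T (Real l)
              & forall m : nzpath L, pi (s (Ghost m)) = T (Ghost m)],
        exists G : {ffun 'I_k -> int} -> set KP,
          is_grading G /\ forall n, G n = KP_component p s n
      & forall (v : vertex L) (r : R), r != 0 -> r *: p v != 0].
Proof.
exists (KP_algebra L R), (@KP_vertex _ L R), (@KP_symbol _ L R); split.
- exact: KP_universal_family.
- exact: KP_generates.
- move=> A Q T QT; have [pi [pi_hom piv pis]] := KP_lift QT.
  exists pi; split=> [|f [f_hom fv fr fg]]; first by split.
  apply: (nualg_hom_unique (@KP_generates _ L R)) => // _ [[v _ <-]|[[l|l] _ <-]].
  + by rewrite piv fv.
  + by rewrite pis fr.
  + by rewrite pis fg.
- exists (KP_component (@KP_vertex _ L R) (@KP_symbol _ L R)); split=> //.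
  exact: KP_grading.
- by move=> v r; apply: KP_vertex_neq0.
Qed.
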